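(* Let $q=p$ be a prime, let $1\le\ell\le q-1$, and let $Y=\mathbb{F}_q[x_1,\dots,x_\ell,\theta]$. Let $V_\ell$ be the set of multisets $\nu=\{\nu_1,\dots,\nu_\ell\}$ of $\ell$ nonnegative integers, and write $q^\nu=q^{\nu_1}+\dots+q^{\nu_\ell}$. Let $(b_{q^\nu})_{\nu\in V_\ell}$ and $(c_{q^\nu})_{\nu\in V_\ell}$ be two families of translation invariant elements of $Y$, each satisfying, for all $\nu\in V_\ell$, the recurrence \[ b_{q^\nu}\prod_{i=1}^\ell x_i=\sum_{I\subset\{1,\dots,\ell\}}b_{q^{\nu^+(I)}}\prod_{j\in I^c}\theta^{q^{\nu_j}}. \] If $b_\ell=c_\ell$ (the terms indexed by $\nu=\{0,\dots,0\}$), then $b_{q^\nu}=c_{q^\nu}$ for all $\nu\in V_\ell$.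
   Context: For $I\subset\{1,\dots,\ell\}$ with complement $I^c$ in $\{1,\dots,\ell\}$, $\nu^+(I)$ is the multiset $\{1+\nu_i:i\in I\}\cup\{\nu_j:j\in I^c\}\in V_\ell$. (Since $\ell\le q-1$, $\nu\mapsto q^\nu$ is injective on $V_\ell$, so indexing by $q^\nu$ is indexing by $\nu$.) Define $D_1:Y\to Y$ by $D_1f(x_1,\dots,x_\ell,\theta)=f(x_1+1,\dots,x_\ell+1,\theta+1)-f(x_1,\dots,x_\ell,\theta)$; an element $y\in Y$ is translation invariant if $D_1(y)=0$, and a family is translation invariant if each member is. *)

(* Defs.v *)
From HB Require Import structures.
From mathcomp Require Import all_boot all_order all_algebra.
From mathcomp Require Import finmap multiset mpoly.

Set Implicit Arguments.
Unset Strict Implicit.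
Unset Printing Implicit Defensive.

Import GRing.Theory.
Local Open Scope ring_scope.
Local Open Scope mset_scope.

(* F_q[x_1, .., x_l, theta], for q prime: variables 0, .., l - 1 are the x_i   *)
(* and the last variable is theta.                                            *)
Notation Y q l := {mpoly 'F_q[l.+1]}.

Definition xvar (q l : nat) (i : 'I_l) : Y q l := 'X_(widen_ord (leqnSn l) i).
Definition theta (q l : nat) : Y q l := 'X_(@ord_max l).

Definition D1 (q l : nat) (f : Y q l) : Y q l :=
  comp_mpoly [tuple 'X_k + 1 | k < l.+1] f - f.

Definition translation_invariant (q l : nat) (f : Y q l) : Prop := D1 f = 0.

Definition V (l : nat) := {nu : {mset nat} | size nu == l}.

Lemma size_seq_mset_tuple (l : nat) (t : l.-tuple nat) :
  size (seq_mset t) == l.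
Proof. by rewrite (perm_size (perm_eq_seq_mset t)) size_tuple. Qed.

(* The multiset {t_1, .., t_l}; every element of V l arises in this way.      *)
Definition V_of_tuple (l : nat) (t : l.-tuple nat) : V l :=
  exist _ (seq_mset t) (size_seq_mset_tuple t).

Definition nuplus (l : nat) (nu : l.-tuple nat) (I : {set 'I_l}) :
    l.-tuple nat :=
  [tuple (if i \in I then 1 + tnth nu i else tnth nu i)%N | i < l].

(* A family b : V l -> Y q l is the family (b_{q^nu}) of the text, indexed by *)
(* nu itself.  Each multiset nu is given by an enumeration nu_1, .., nu_l, on *)
(* which neither side depends, since nuplus commutes with reordering.         *)
Definition recurrence (q l : nat) (b : V l -> Y q l) : Prop :=
  forall nu : l.-tuple nat,
    b (V_of_tuple nu) * \prod_(i < l) xvar q i =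
    \sum_(I : {set 'I_l})
      b (V_of_tuple (nuplus nu I)) *
      \prod_(j in ~: I) theta q l ^+ (q ^ tnth nu j)%N.

Definition V0 (l : nat) : V l := V_of_tuple [tuple of nseq l 0%N].

(* Main.v *)
(* By linearity, consider d = b - c, which vanishes at nu = {0, .., 0}.       *)
(* Translating the recurrence by n in F_q replaces x_i by x_i + n and         *)
(* theta^{q^{nu_j}} by theta^{q^{nu_j}} + n; both sides are polynomials in n  *)
(* of degree at most l < q, so the coefficients of n^{l-k} may be compared.   *)
(* If d vanishes on all multisets of sum smaller than |nu| + k, this gives    *)
(*   sum_{|I| = k} d_{nu^+(I)} = 0   for k >= 1.                              *)
(* For mu with exactly k > 0 nonzero parts, take nu to be mu with every       *)
(* nonzero part lowered by one: nu^+(I) has more than k nonzero parts unless  *)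
(* I contains the support of nu, in which case it is mu.  An induction on the *)
(* sum and then on the number of zero parts yields 'C(r, m) d_mu = 0 with     *)
(* m <= r <= l < q, hence d_mu = 0.                                           *)
Require Import Defs.
From mathcomp Require Import all_boot all_order all_algebra.
From mathcomp Require Import finmap multiset mpoly.
From mathcomp Require Import zify.

Set Implicit Arguments.
Unset Strict Implicit.
Unset Printing Implicit Defensive.

Import GRing.Theory.
Local Open Scope ring_scope.

(** If [d nu = 0], the left side of the recurrence vanishes; translation fixes every [d] and adds 1
    to each power of [theta], so the right side stays zero under all shifts by [n]
    ([translated_recurrence]). Comparing coefficients in [n] isolates the sets [I] of a given size
    ([sum_card_eq0]). A double induction, on the weight and then on the number of zero entries,
    leaves a single unknown [d mu] times a binomial coefficient prime to [q]
    ([invariant_recurrence_eq0]). *)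

Lemma natr_inj_lt_pchar (A : nzRingType) (q m n : nat) :
  q \in [pchar A] -> (m < q)%N -> (n < q)%N ->
  m%:R = n%:R :> A -> m = n.
Proof.
move=> qA; wlog le_mn : m n / (m <= n)%N => [hw lt_m lt_n eq_mn|lt_m lt_n eq_mn].
  by case/orP: (leq_total m n) => le; [|apply/esym]; apply: hw.
have : (q %| n - m)%N by rewrite (dvdn_pcharf qA) natrB // eq_mn subrr.
case: (posnP (n - m)) => [|nm_gt0 /(dvdn_leq nm_gt0)]; lia.
Qed.

Lemma prime_ndvd_fact (q n : nat) : prime q -> (n < q)%N -> ~~ (q %| n`!)%N.
Proof.
move=> q_prime; elim: n => [|n IHn] lt_nq.
  by rewrite fact0 gtnNdvd ?prime_gt1.
by rewrite factS Euclid_dvdM // negb_or gtnNdvd //= IHn // ltnW.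
Qed.

Lemma prime_ndvd_bin (q n m : nat) :
  prime q -> (m <= n < q)%N -> ~~ (q %| 'C(n, m))%N.
Proof.
move=> q_prime /andP[le_mn /(prime_ndvd_fact q_prime)].
by apply: contra => /dvdn_mulr dvd_q; rewrite -(bin_fact le_mn) dvd_q.
Qed.

Section ProdXaddC.
Variables (A : idomainType) (T : finType) (y : T -> A) (S : {set T}).

Let P : {poly A} := \prod_(j in S) ('X + (y j)%:P).

Let prodE : P = \prod_(j <- enum S) ('X - (- y j)%:P).
Proof.
by rewrite big_enum; apply: eq_bigr => j _; rewrite polyCN opprK.
Qed.

Lemma size_prod_XaddC : size P = #|S|.+1.
Proof. by rewrite prodE size_prod_XsubC cardE. Qed.

Lemma coef_prod_XaddC_card : P`_#|S| = 1.
Proof.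
have := monic_prod_XsubC (enum S) xpredT (fun j => - y j).
by rewrite -prodE => /monicP; rewrite lead_coefE size_prod_XaddC.
Qed.

End ProdXaddC.

(** As a polynomial in [n] the sum has degree at most [l], yet [q > l] distinct roots, so it is
    zero. In degree [l - k], sets with fewer than [k] elements drop out by hypothesis, larger ones
    have too small a degree, and those of size [k] give monic products. *)
Lemma sum_card_eq0 (A : idomainType) (q l k : nat) (f : {set 'I_l} -> A)
    (y : 'I_l -> A) :
  q \in [pchar A] -> (l < q)%N -> (k <= l)%N ->
  (forall I : {set 'I_l}, (#|I| < k)%N -> f I = 0) ->
  (forall n : nat, \sum_I f I * \prod_(j in ~: I) (y j + n%:R) = 0) ->
  \sum_(I : {set 'I_l} | #|I| == k) f I = 0.
Proof.
move=> qA lt_lq le_kl f0 sum0.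
pose Q (I : {set 'I_l}) : {poly A} := \prod_(j in ~: I) ('X + (y j)%:P).
have cardI (I : {set 'I_l}) : (#|I| + #|~: I| = l)%N by rewrite cardsC card_ord.
pose P : {poly A} := \sum_I (f I)%:P * Q I.
have P_eq0 : P = 0.
  apply/eqP/negPn/negP => P_neq0.
  have := @max_poly_roots _ P [seq n%:R | n <- iota 0 q] P_neq0.
  have -> : all (root P) [seq n%:R | n <- iota 0 q].
    apply/allP => _ /mapP[n _ ->]; rewrite /root horner_sum.
    rewrite -[X in _ == X](sum0 n); apply/eqP/eq_bigr => I _.
    rewrite hornerM hornerC horner_prod; congr (_ * _).
    by apply: eq_bigr => j _; rewrite hornerD hornerX hornerC addrC.
  rewrite size_map size_iota map_inj_in_uniq ?iota_uniq; last first.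
    move=> m n; rewrite !mem_iota !add0n /= => lt_m lt_n.
    exact: natr_inj_lt_pchar qA lt_m lt_n.
  move=> /(_ isT isT); apply/negP; rewrite -leqNgt (leq_trans _ lt_lq) //.
  apply: (leq_trans (size_sum _ _ _)); apply/bigmax_leqP => I _.
  rewrite mul_polyC (leq_trans (size_scale_leq _ _)) // size_prod_XaddC.
  by have := cardI I; lia.
rewrite -[RHS](coef0 A (l - k)) -P_eq0 coef_sum big_mkcond /=.
apply: eq_bigr => I _; rewrite coefCM.
have := cardI I; case: (ltngtP #|I| k) => [/f0 ->|lt_k|eq_k] eq_l.
- by rewrite mul0r.
- by rewrite [(Q I)`_ _]nth_default ?mulr0 // size_prod_XaddC; lia.
- have -> : (l - k = #|~: I|)%N by lia.
  by rewrite coef_prod_XaddC_card mulr1.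
Qed.

Section TranslationInvariantRecurrence.
Variables (A : idomainType) (q l : nat).
Hypotheses (qA : q \in [pchar A]) (lt_lq : (l < q)%N).
Variables (tau : {rmorphism A -> A}) (th : A) (d : l.-tuple nat -> A).
Hypothesis tau_th : tau th = th + 1.
Hypothesis tau_d : forall nu, tau (d nu) = d nu.
Hypothesis d_perm : forall mu nu : l.-tuple nat, perm_eq mu nu -> d mu = d nu.
Variable x : A.
Hypothesis d_rec : forall nu, d nu * x =
  \sum_(I : {set 'I_l})
     d (nuplus nu I) * \prod_(j in ~: I) th ^+ (q ^ tnth nu j)%N.
Hypothesis d0 : d [tuple of nseq l 0%N] = 0.

Let q_prime : prime q := pcharf_prime qA.

(** Frobenius is additive and fixes 1. *)
Lemma tau_theta_exp (m : nat) : tau (th ^+ (q ^ m)%N) = th ^+ (q ^ m)%N + 1.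
Proof.
elim: m => [|m IHm]; first by rewrite expn0 expr1.
rewrite expnSr exprM rmorphXn IHm -!(pFrobenius_autE qA).
by rewrite rmorphD rmorph1.
Qed.

Lemma translated_recurrence (nu : l.-tuple nat) (n : nat) : d nu = 0 ->
  \sum_(I : {set 'I_l}) d (nuplus nu I) *
    \prod_(j in ~: I) (th ^+ (q ^ tnth nu j)%N + n%:R) = 0.
Proof.
move=> d_nu; elim: n => [|n IHn].
  transitivity (d nu * x); last by rewrite d_nu mul0r.
  rewrite d_rec; apply: eq_bigr => I _; congr (_ * _).
  by apply: eq_bigr => j _; rewrite addr0.
transitivity (tau (\sum_(I : {set 'I_l}) d (nuplus nu I) *
    \prod_(j in ~: I) (th ^+ (q ^ tnth nu j)%N + n%:R))).
  2: by rewrite IHn rmorph0.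
rewrite rmorph_sum; apply: eq_bigr => I _.
rewrite rmorphM tau_d rmorph_prod; congr (_ * _); apply: eq_bigr => j _.
by rewrite rmorphD tau_theta_exp rmorph_nat -addrA -natr1 [1 + _]addrC.
Qed.

Let weight (nu : l.-tuple nat) := (\sum_(i < l) tnth nu i)%N.
Let supp (nu : l.-tuple nat) : {set 'I_l} := [set i | tnth nu i != 0]%N.
Let lower (nu : l.-tuple nat) : l.-tuple nat := [tuple (tnth nu i).-1 | i < l].

Lemma weight_nuplus (nu : l.-tuple nat) (I : {set 'I_l}) :
  weight (nuplus nu I) = (weight nu + #|I|)%N.
Proof.
rewrite -sum1_card [X in (_ + X)%N]big_mkcond -big_split /=.
by apply: eq_bigr => i _; rewrite tnth_mktuple; case: (i \in I); lia.
Qed.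

Lemma nuplus_lower (mu : l.-tuple nat) : nuplus (lower mu) (supp mu) = mu.
Proof.
by apply: eq_from_tnth => i; rewrite !tnth_mktuple inE; case: (tnth mu i).
Qed.

Lemma supp_nuplus (nu : l.-tuple nat) (I : {set 'I_l}) :
  supp (nuplus nu I) = I :|: supp nu.
Proof.
by apply/setP => i; rewrite !inE tnth_mktuple; case: (i \in I).
Qed.

Lemma count_tuple (mu : l.-tuple nat) (a : nat) :
  count_mem a mu = #|[set i | tnth mu i == a]|.
Proof.
rewrite -[in LHS](map_tnth_enum mu) count_map enumT cardE size_filter.
by apply: eq_count => i /=; rewrite inE.
Qed.

(** Every nonzero entry of [nu] is raised in both cases, so the only choice is which zeros become
    ones, and their number is the same. *)
Lemma perm_nuplus (nu : l.-tuple nat) (I J : {set 'I_l}) :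
  supp nu \subset I -> supp nu \subset J -> #|I| = #|J| ->
  perm_eq (nuplus nu I) (nuplus nu J).
Proof.
have level (K : {set 'I_l}) a : supp nu \subset K ->
    [set i | tnth (nuplus nu K) i == a] =
    if a is b.+1 then
      if b == 0%N then K :\: supp nu else [set i | tnth nu i == b]
    else ~: K.
  move=> /subsetP sK; apply/setP => i; rewrite inE tnth_mktuple.
  have := sK i; rewrite inE.
  case: a => [|[|b]] /=; rewrite !inE; case: (i \in K) => /=;
    case: (tnth nu i) => [|m] //= /(_ isT) //.
move=> sI sJ eq_IJ; apply/allP => a _; apply/eqP.
rewrite -[LHS]/(count_mem a _) -[RHS]/(count_mem a _).
rewrite !count_tuple !level //; case: a => [|b].
  by apply: (@addnI #|I|); rewrite cardsC eq_IJ cardsC.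
by case: eqP => // _; rewrite !cardsD !(setIidPr _) // eq_IJ.
Qed.

(** Complementation turns these sets into the subsets of [~: S] with [l - k] elements. *)
Lemma card_supersets (S : {set 'I_l}) (k : nat) : (k <= l)%N ->
  #|[set I : {set 'I_l} | S \subset I & #|I| == k]| = 'C(l - #|S|, l - k).
Proof.
move=> le_kl; have -> : (l - #|S|)%N = #|~: S|.
  by have := cardsC S; rewrite card_ord; lia.
rewrite -cards_draws -[RHS](card_imset _ (can_inj (@setCK _))).
apply: eq_card => I; rewrite -{2}[I]setCK mem_imset.
  2: exact: can_inj (@setCK _).
rewrite !inE setCS; congr (_ && _).
by have := cardsC I; rewrite card_ord => eq_l; apply/eqP/eqP; lia.
Qed.

Lemma invariant_recurrence_eq0 (mu : l.-tuple nat) : d mu = 0.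
Proof.
move: {2}(weight mu).+1 (ltnSn (weight mu)) => s.
elim: s mu => [//|s IHs] mu; rewrite ltnS => le_s.
(* The inner induction is on the number of zero entries of [mu]. *)
move: {2}(l - #|supp mu|).+1 (ltnSn (l - #|supp mu|)) => z.
elim: z mu le_s => [//|z IHz] mu le_s; rewrite ltnS => le_z.
set k := #|supp mu|; set nu := lower mu.
have le_kl : (k <= l)%N by rewrite -[X in (_ <= X)%N]card_ord max_card.
have w_mu : weight mu = (weight nu + k)%N by rewrite -weight_nuplus nuplus_lower.
have [k0|k_gt0] := posnP k.
  suff -> : mu = [tuple of nseq l 0%N] by [].
  apply: eq_from_tnth => i; rewrite tnth_nseq.
  by move/cards0_eq/setP/(_ i): k0; rewrite !inE => /negbFE/eqP.
have low (I : {set 'I_l}) : (#|I| < k)%N -> d (nuplus nu I) = 0.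
  by move=> lt_k; apply: IHs; rewrite weight_nuplus; lia.
have d_nu : d nu = 0 by apply: IHs; lia.
have := sum_card_eq0 qA lt_lq le_kl low
  (fun n => translated_recurrence n d_nu).
have s_nu : supp nu \subset supp mu.
  by rewrite -[X in _ \subset supp X]nuplus_lower supp_nuplus subsetUr.
rewrite (bigID (fun I : {set 'I_l} => supp nu \subset I)) /= addrC.
rewrite big1 ?add0r; last first.
  (* The support of [nuplus nu I] is [I :|: supp nu], strictly larger than [I]: same weight as [mu],
     but fewer zeros. *)
  move=> I /andP[/eqP cI nsub]; apply: IHz.
    by rewrite weight_nuplus cI -w_mu.
  have : (#|I| < #|supp (nuplus nu I)|)%N.
    by rewrite supp_nuplus proper_card // properUl.
  have : (#|supp (nuplus nu I)| <= l)%N.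
    by rewrite -[X in (_ <= X)%N]card_ord max_card.
  rewrite cI => le_l lt_k; apply: leq_trans le_z.
  exact: ltn_sub2l (leq_trans lt_k le_l) lt_k.
(* The remaining [nuplus nu I] all rearrange [mu], which is the case [I = supp mu]. *)
rewrite (eq_bigr (fun=> d mu)) => [|I /andP[/eqP cI sub]]; last first.
  by rewrite -[X in _ = d X]nuplus_lower; apply/d_perm/perm_nuplus.
rewrite sumr_const (_ : #|_| = 'C(l - #|supp nu|, l - k)); last first.
  by rewrite -card_supersets //; apply: eq_card => I; rewrite !inE andbC.
move/eqP; rewrite -mulr_natr mulf_eq0 -(dvdn_pcharf qA).
rewrite (negPf (prime_ndvd_bin q_prime _)) ?orbF => [/eqP //|].
by have := subset_leq_card s_nu; lia.
Qed.

End TranslationInvariantRecurrence.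

Lemma V_of_tuple_perm (l : nat) (s t : l.-tuple nat) :
  perm_eq s t -> V_of_tuple s = V_of_tuple t.
Proof. by move=> st; apply: val_inj; apply/eq_seq_msetP. Qed.

Lemma V_of_tuple_surj (l : nat) (nu : V l) : exists t, nu = V_of_tuple t.
Proof.
by case: nu => s sz; exists (Tuple sz); apply: val_inj; rewrite /= seq_mset_id.
Qed.

Theorem theorem3p1 (q l : nat) (q_prime : prime q)
    (l_ge1 : (1 <= l)%N) (l_le : (l <= q - 1)%N)
    (b c : V l -> Y q l)
    (b_inv : forall nu : V l, translation_invariant (b nu))
    (c_inv : forall nu : V l, translation_invariant (c nu))
    (b_rec : recurrence b) (c_rec : recurrence c)
    (bc0 : b (V0 l) = c (V0 l)) :
  forall nu : V l, b nu = c nu.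
Proof.
move=> nu; have [t ->] := V_of_tuple_surj nu.
apply/eqP; rewrite -subr_eq0; apply/eqP.
have qY : q \in [pchar Y q l] by rewrite pchar_lalg pchar_Fp.
have lt_lq : (l < q)%N by have := prime_gt0 q_prime; lia.
pose tau : {rmorphism Y q l -> Y q l} :=
  comp_mpoly [tuple 'X_k + 1 | k < l.+1].
(* Invariance and the recurrence are linear in the family, so both pass to [b - c]. *)
apply: (@invariant_recurrence_eq0 _ q l qY lt_lq tau (theta q l)
  (fun s => b (V_of_tuple s) - c (V_of_tuple s)) _ _ _
  (\prod_(i < l) xvar q i)).
- by rewrite /= comp_mpolyXU -tnth_nth tnth_mktuple.
- move=> s; rewrite rmorphB; congr (_ - _); apply/eqP; rewrite -subr_eq0.
    exact/eqP/b_inv.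
  exact/eqP/c_inv.
- by move=> s s' /V_of_tuple_perm ->.
- move=> s; rewrite mulrBl b_rec c_rec -sumrB.
  by apply: eq_bigr => I _; rewrite mulrBl.
- by rewrite -/(V0 l) bc0 subrr.
Qed.
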